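(* For any $d\ge1$, $1\le p<\infty$ and $1\le q\le p^*=p/(p-1)$, any width $H$, any $\psi,\mu\ge0$ and any set $\mathcal S=\{x_1,\dots,x_m\}\subseteq\mathbb R^n$, $$\mathcal R_m(\mathcal F^{d,H}_{\psi_{p,q}\le\psi})\le\psi\,2^{d-1}\,\mathcal R^{\mathrm{linear}}_{m,p,n}\le\sqrt{\frac{\psi^2\left(2H^{[\frac1{p^*}-\frac1q]_+}\right)^{2(d-1)}\min\{p^*,4\log(2n)\}\max_i\|x_i\|_{p^*}^2}{m}}$$ and so $$\mathcal R_m(\mathcal F^{d,H}_{\mu_{p,q}\le\mu})\le\left(2\mu/\sqrt[q]{d}\right)^d\mathcal R^{\mathrm{linear}}_{m,p,n}\le\sqrt{\frac{\left(2\mu/\sqrt[q]{d}\right)^{2d}\min\{p^*,4\log(2n)\}\max_i\|x_i\|_{p^*}^2}{m}},$$ where in both lines the second inequality is asserted only if $1\le p\le2$.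
   Context: Let $\sigma(z)=\max(z,0)$ (ReLU), applied entrywise. $\mathcal F^{d,H}$ is the class of functions $f_w:\mathbb R^n\to\mathbb R$ computed by depth-$d$, width-$H$ fully connected networks with a single output, $f_w(x)=W^d\sigma(W^{d-1}\sigma(\cdots\sigma(W^1x)))$, with $W^1\in\mathbb R^{H\times n}$, $W^k\in\mathbb R^{H\times H}$ for $1<k<d$, $W^d\in\mathbb R^{1\times H}$ (if $d=1$, $f_w(x)=W^1x$ with $W^1\in\mathbb R^{1\times n}$); $w=(W^1,\dots,W^d)$. The width may also be unbounded ($H=\infty$: the number of units is allowed to be as large as needed). Under the hypothesis $q\le p^*$ the exponent $[\frac1{p^*}-\frac1q]_+$ equals $0$, so $H^{[\cdot]_+}=1$ (also for $H=\infty$). For a matrix $W$, $\|W\|_{p,q}=\big(\sum_i(\sum_j|W[i,j]|^p)^{q/p}\big)^{1/q}$, with the usual convention (max) for $q=\infty$, and $1/\infty=0$ (for $p=1$, $p^*=\infty$). Define $\mu_{p,q}(w)=\big(\sum_{k=1}^d\|W^k\|_{p,q}^q\big)^{1/q}$ and $\psi_{p,q}(w)=\prod_{k=1}^d\|W^k\|_{p,q}$. For $f\in\mathcal F^{d,H}$ let $\mu^{d,H}_{p,q}(f)=\inf_{f_w=f}\mu_{p,q}(w)$ and $\psi^{d,H}_{p,q}(f)=\inf_{f_w=f}\psi_{p,q}(w)$, and let $\mathcal F^{d,H}_{\psi_{p,q}\le\psi}=\{f\in\mathcal F^{d,H}:\psi^{d,H}_{p,q}(f)\le\psi\}$, $\mathcal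 F^{d,H}_{\mu_{p,q}\le\mu}=\{f\in\mathcal F^{d,H}:\mu^{d,H}_{p,q}(f)\le\mu\}$. The empirical Rademacher complexity with respect to $\mathcal S$ is $\mathcal R_m(\mathcal F)=\mathbb E_{\xi}\big[\frac1m\sup_{f\in\mathcal F}|\sum_{i=1}^m\xi_if(x_i)|\big]$ with $\xi$ uniform on $\{\pm1\}^m$. $\mathcal R^{\mathrm{linear}}_{m,p,n}$ is the Rademacher complexity with respect to $\mathcal S$ of the class $\{x\mapsto\langle v,x\rangle: v\in\mathbb R^n,\ \|v\|_p\le1\}$. $[a]_+=\max(a,0)$. *)

(* Defs.v *)
From HB Require Import structures.
From mathcomp Require Export all_boot all_order all_algebra.
From mathcomp Require Export all_classical all_reals all_analysis.

Set Implicit Arguments.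
Unset Strict Implicit.
Unset Printing Implicit Defensive.

Import Order.TTheory GRing.Theory Num.Theory.

Local Open Scope classical_set_scope.
Local Open Scope ring_scope.

(* Only used for exponents p >= 1; the value at -oo is irrelevant. *)
Definition lpnorm (R : realType) (p : \bar R) (I : finType) (v : I -> R) : R :=
  match p with
  | r%:E => (\sum_i `|v i| `^ r) `^ r^-1
  | +oo%E => \big[Num.max/0]_i `|v i|
  | -oo%E => 0
  end.

Definition vnorm (R : realType) (p : \bar R) (n : nat) (x : 'cV[R]_n) : R :=
  lpnorm p (fun j => x j 0).

Definition mxnorm (R : realType) (p q : \bar R) (a b : nat) (W : 'M[R]_(a, b))
    : R :=
  lpnorm q (fun i => lpnorm p (W i)).

Definition relu (R : realType) (h : nat) (z : 'cV[R]_h) : 'cV[R]_h :=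
  map_mx (fun t => Num.max t 0) z.

(* [network R n h d]: the weights (W^1, ..., W^d) of a depth-d network on R^n
   all of whose hidden layers have h units. The tuple in [Deep] lists the h x h
   matrices W^2, ..., W^(d-1) from the input side to the output side. There is
   no network of depth 0. *)
Inductive network (R : realType) (n h : nat) : nat -> Type :=
| Linear of 'M[R]_(1, n) : network R n h 1
| Deep k of 'M[R]_(h, n) & k.-tuple 'M[R]_h & 'M[R]_(1, h) :
    network R n h k.+2.

Definition net_fun (R : realType) (n h d : nat) (w : network R n h d)
    : 'cV[R]_n -> R :=
  match w with
  | Linear W1 => fun x => (W1 *m x) 0 0
  | Deep _ W1 Ws Wd => fun x =>
      (Wd *m relu (foldl (fun z W => W *m relu z) (W1 *m x) Ws)) 0 0
  end.

Definition layer_norms (R : realType) (p q : \bar R) (n h d : nat)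
    (w : network R n h d) : d.-tuple R :=
  match w in network _ _ _ d return d.-tuple R with
  | Linear W1 => [tuple mxnorm p q W1]
  | Deep _ W1 Ws Wd =>
      [tuple of mxnorm p q W1 ::
                rcons [seq mxnorm p q W | W <- Ws] (mxnorm p q Wd)]
  end.

Definition net_mu (R : realType) (p q : \bar R) (n h d : nat)
    (w : network R n h d) : R :=
  lpnorm q (tnth (layer_norms p q w)).

Definition net_psi (R : realType) (p q : \bar R) (n h d : nat)
    (w : network R n h d) : R :=
  \prod_(k < d) tnth (layer_norms p q w) k.

Inductive width := Width of nat | Unbounded.

Definition width_ereal (R : realType) (H : width) : \bar R :=
  match H with Width h => (h%:R)%:E | Unbounded => +oo%E end.

(* Unbounded width means that every finite positive width may be used. *)
Definition widths (H : width) : set nat :=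
  match H with Width h => [set h] | Unbounded => [set h | (0 < h)%N] end.

Definition net_class (R : realType) (n d : nat) (H : width)
    : set ('cV[R]_n -> R) :=
  [set f | exists2 h, widths H h &
           exists w : network R n h d, net_fun w = f].

Definition fun_mu (R : realType) (p q : \bar R) (n d : nat) (H : width)
    (f : 'cV[R]_n -> R) : \bar R :=
  ereal_inf [set y | exists2 h, widths H h &
                     exists2 w : network R n h d, net_fun w = f &
                     y = (net_mu p q w)%:E].

Definition fun_psi (R : realType) (p q : \bar R) (n d : nat) (H : width)
    (f : 'cV[R]_n -> R) : \bar R :=
  ereal_inf [set y | exists2 h, widths H h &
                     exists2 w : network R n h d, net_fun w = f &
                     y = (net_psi p q w)%:E].

Definition net_class_mu (R : realType) (p q : \bar R) (n d : nat) (H : width)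
    (mu : R) : set ('cV[R]_n -> R) :=
  [set f | net_class d H f /\ (fun_mu p q d H f <= mu%:E)%E].

Definition net_class_psi (R : realType) (p q : \bar R) (n d : nat) (H : width)
    (psi : R) : set ('cV[R]_n -> R) :=
  [set f | net_class d H f /\ (fun_psi p q d H f <= psi%:E)%E].

(* The sign vector is encoded by its exponents: the i-th sign is
   (-1) ^+ xi i with xi i a boolean. *)
Definition rademacher (R : realType) (X : Type) (m : nat) (x : 'I_m -> X)
    (F : set (X -> R)) : \bar R :=
  (((2 ^+ m)^-1)%:E * \sum_(xi : {ffun 'I_m -> bool})
     (m%:R^-1)%:E *
     ereal_sup [set (`|\sum_(i < m) (-1) ^+ xi i * f (x i)|%R)%:E | f in F])%E.

Definition linear_class (R : realType) (p : \bar R) (n : nat)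
    : set ('cV[R]_n -> R) :=
  [set f | exists2 v : 'cV[R]_n, vnorm p v <= 1 &
           f = (fun x : 'cV[R]_n => \sum_(j < n) v j 0 * x j 0)].

Definition rademacher_linear (R : realType) (p : \bar R) (n m : nat)
    (x : 'I_m -> 'cV[R]_n) : \bar R :=
  rademacher x (@linear_class R p n).

(* Main.v *)
Require Import Defs.
From mathcomp Require Import ring lra.

(* Fix the sample x_1, ..., x_m and a sign vector. Replacing each layer by its
   rows scaled to unit norm, positive homogeneity of the ReLU and Hoelder's
   inequality (with q <= p^* ) show that the values of a network at the sample
   are the product of its layer norms times a vector of the set T_d, where T_1
   consists of the values of the unit-norm linear maps and T_(k+1) is the
   absolutely convex hull of relu(T_k). A linear functional has the same supremum
   of absolute values on relu(T_k) as on its hull, and the contraction principle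
   removes the ReLU at the cost of a factor 2, since T_k is symmetric. The sum of
   the q-th powers controls the product by the AM-GM inequality.

   For the linear class, the supremum is the l_{p^*} norm of the signed sum of
   the x_i, hence at most its l_r norm with r = min(p^*, 4 log(2n)). Jensen's
   inequality and the sub-Gaussian moment bound
   E |S|^r <= 2 (r |a|_2^2 / e)^(r/2), for S the signed sum of the a_i, bound its
   mean by sqrt (r m) max_i |x_i|_{p^*}. *)

Set Implicit Arguments.
Unset Strict Implicit.
Unset Printing Implicit Defensive.

Import Order.TTheory GRing.Theory Num.Theory.

Local Open Scope classical_set_scope.
Local Open Scope ring_scope.

(** * Norms on finite families *)

Lemma lpnorm_ge0 (R : realType) (p : \bar R) (I : finType) (v : I -> R) :
  0 <= lpnorm p v.
Proof.
case: p => [r| |] //=; first exact: powR_ge0.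
by elim/big_ind: _ => // x y x0 y0; rewrite le_max x0.
Qed.

Lemma lpnorm_powR (R : realType) (r : R) (I : finType) (v : I -> R) :
  0 < r -> lpnorm r%:E v `^ r = \sum_i `|v i| `^ r.
Proof.
move=> r0; rewrite /= -powRrM mulVf ?gt_eqF// powRr1//.
by apply: sumr_ge0 => i _; exact: powR_ge0.
Qed.

Lemma powR_le_inj (R : realType) (r x y : R) :
  0 < r -> 0 <= x -> 0 <= y -> x `^ r <= y `^ r -> x <= y.
Proof.
move=> r0 x0 y0 /(@ge0_ler_powR _ r^-1).
rewrite !nnegrE !powR_ge0 -!powRrM divff ?gt_eqF// !powRr1//.
by apply; rewrite ?invr_ge0 ?ltW.
Qed.

Lemma ler_lpnorm (R : realType) (q : \bar R) (I : finType) (v : I -> R) i :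
  (1 <= q)%E -> `|v i| <= lpnorm q v.
Proof.
case: q => [r| _|//]; last by rewrite /= (bigD1 i)//= le_max lexx.
rewrite lee_fin => r1; have r0 : 0 < r by exact: lt_le_trans r1.
apply: (powR_le_inj r0); rewrite ?lpnorm_ge0// lpnorm_powR// (bigD1 i)//=.
by rewrite lerDl sumr_ge0// => j _; exact: powR_ge0.
Qed.

(** Each |v_i| is at most the l_q norm N, so |v_i|^r = |v_i|^q |v_i|^(r-q) is at most |v_i|^q
    N^(r-q); summing over i gives N^r. *)
Lemma le_lpnorm_fin (R : realType) (q r : R) (I : finType) (v : I -> R) :
  1 <= q -> q <= r -> lpnorm r%:E v <= lpnorm q%:E v.
Proof.
move=> q1 qr.
have q0 : 0 < q by exact: lt_le_trans q1.
have r0 : 0 < r by exact: lt_le_trans qr.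
have vN i : `|v i| <= lpnorm q%:E v by apply: ler_lpnorm; rewrite lee_fin.
have Mr := lpnorm_powR v r0; have Nq := lpnorm_powR v q0.
move: (lpnorm_ge0 r%:E v) (lpnorm_ge0 q%:E v) Mr Nq vN.
move: (lpnorm r%:E v) (lpnorm q%:E v) => M N M0 N0 Mr Nq vN.
apply: (powR_le_inj r0) => //.
have split_exponent (x : R) : x `^ r = x `^ q * x `^ (r - q).
  by rewrite -powRD; [congr powR; ring | rewrite addrC subrK gt_eqF].
rewrite Mr [N `^ r]split_exponent Nq mulr_suml; apply: ler_sum => i _.
rewrite split_exponent ler_wpM2l ?powR_ge0//.
by apply: ge0_ler_powR; rewrite ?subr_ge0 ?nnegrE.
Qed.

Lemma le_lpnorm (R : realType) (q r : \bar R) (I : finType) (v : I -> R) :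
  (1 <= q)%E -> (q <= r)%E -> lpnorm r v <= lpnorm q v.
Proof.
move: r q => [r| |] [q| |] q1 qr; try discriminate.
- by rewrite !lee_fin in q1 qr; exact: le_lpnorm_fin.
- apply: bigmax_le => [|i _]; first exact: lpnorm_ge0.
  exact: ler_lpnorm.
- exact: lexx.
Qed.

Lemma lpnormZ (R : realType) (q : \bar R) (I : finType) (v : I -> R) (c : R) :
  (1 <= q)%E -> lpnorm q (fun i => c * v i) = `|c| * lpnorm q v.
Proof.
case: q => [r|_|//].
  rewrite lee_fin => r1; have r0 : 0 < r by exact: lt_le_trans r1.
  rewrite /=; under eq_bigr do rewrite normrM powRM//.
  rewrite -mulr_sumr powRM ?powR_ge0//.
    by rewrite -powRrM divff ?gt_eqF// powRr1.
  by apply: sumr_ge0 => i _; exact: powR_ge0.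
rewrite /=; under eq_bigr do rewrite normrM.
elim/big_ind2 : _ => [|x1 x2 y1 y2 -> ->|//]; first by rewrite mulr0.
by rewrite maxr_pMr.
Qed.

Lemma hoelder_conjugate_fin (R : realType) (p : R) :
  1 < p -> hoelder_conjugate p%:E = (p / (p - 1))%:E.
Proof.
move=> p1; rewrite /hoelder_conjugate /= eqe gt_eqF ?(lt_trans _ p1)//.
by rewrite -EFinB inver subr_eq0 gt_eqF// -EFinM.
Qed.

(** Young's inequality for the entries divided by the norms. At p = 1 the conjugate exponent is
    infinite and each [|w i|] is bounded by the maximum. *)
Lemma hoelder_sum (R : realType) (p : R) (I : finType) (v w : I -> R) :
  1 <= p ->
  \sum_i `|v i| * `|w i| <=
  lpnorm p%:E v * lpnorm (hoelder_conjugate p%:E) w.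
Proof.
rewrite le_eqVlt => /predU1P[<-|p1].
  rewrite hoelder_conjugate1 /= invr1 powRr1; last first.
    by apply: sumr_ge0 => i _; exact: powR_ge0.
  rewrite mulr_suml; apply: ler_sum => i _; rewrite powRr1// ler_wpM2l//.
  by apply: (@ler_lpnorm _ +oo%E); exact: leey.
rewrite hoelder_conjugate_fin//; set q := p / (p - 1).
have p0 : 0 < p by exact: lt_trans p1.
have p10 : 0 < p - 1 by rewrite subr_gt0.
have q1 : 1 <= q by rewrite /q ler_pdivlMr// mul1r gerBl.
have q0 : 0 < q by exact: lt_le_trans q1.
have pq : p^-1 + q^-1 = 1 by rewrite /q; field; lra.
have zero (s : R) (u t : I -> R) : 1 <= s -> lpnorm s%:E u = 0 ->
    \sum_i `|u i| * `|t i| = 0.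
  move=> s1 u0; apply: big1 => i _.
  suff -> : `|u i| = 0 by rewrite mul0r.
  by apply/le_anti; rewrite normr_ge0 andbT -u0 ler_lpnorm.
have [v0|v0] := eqVneq (lpnorm p%:E v) 0.
  by rewrite (zero p) ?v0 ?mul0r// ltW.
have [w0|w0] := eqVneq (lpnorm q%:E w) 0.
  by under eq_bigr do rewrite mulrC; rewrite (zero q) ?w0 ?mulr0.
have vA := lpnorm_powR v p0; have wB := lpnorm_powR w q0.
have A0 : 0 < lpnorm p%:E v by rewrite lt0r v0 lpnorm_ge0.
have B0 : 0 < lpnorm q%:E w by rewrite lt0r w0 lpnorm_ge0.
move: (lpnorm p%:E v) (lpnorm q%:E w) A0 B0 vA wB {v0 w0} => A B A0 B0 vA wB.
have Ap0 : A `^ p != 0 by rewrite gt_eqF ?powR_gt0.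
have Bq0 : B `^ q != 0 by rewrite gt_eqF ?powR_gt0.
(* The ratios |v_i|^p / A^p sum to 1, as do |w_i|^q / B^q, and 1/p + 1/q = 1. Young's inequality
   then applies term by term. *)
have -> : A * B = \sum_i A * B * (`|v i| `^ p / A `^ p / p + `|w i| `^ q / B `^ q / q).
  rewrite -mulr_sumr big_split -!mulr_suml -vA -wB !divff//.
  by rewrite /= !mul1r pq mulr1.
have powR_div (x y s : R) : 0 <= x -> 0 < y -> (x / y) `^ s = x `^ s / y `^ s.
  move=> x0 y0; rewrite powRM ?invr_ge0 ?(ltW y0)//; congr (_ * _).
  by rewrite -powR_inv1 ?ltW// -powRrM mulN1r powRN.
apply: ler_sum => i _.
have vi0 : 0 <= `|v i| / A by rewrite divr_ge0// ltW.
have wi0 : 0 <= `|w i| / B by rewrite divr_ge0// ltW.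
have := conjugate_powR vi0 wi0 p0 q0 pq; rewrite !powR_div// => young.
have -> : `|v i| * `|w i| = A * B * (`|v i| / A * (`|w i| / B)).
  by field; rewrite !gt_eqF.
by rewrite ler_wpM2l// mulr_ge0 ?ltW.
Qed.

(** * Contraction by ReLU layers *)

Section signed_sums.
Context {R : realType} {m : nat}.
Implicit Types (xi : {ffun 'I_m -> bool}) (t : 'I_m -> R) (T : set ('I_m -> R)).

Definition signed_sum xi t : R := \sum_(i < m) (-1) ^+ xi i * t i.

Definition flip (i0 : 'I_m) xi : {ffun 'I_m -> bool} :=
  [ffun i => if i == i0 then ~~ xi i else xi i].

Lemma flipK i0 : involutive (flip i0).
Proof.
move=> xi; apply/ffunP => i; rewrite !ffunE.
by case: eqP => // _; rewrite negbK.
Qed.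

Lemma signed_sumN xi t : signed_sum xi (fun i => - t i) = - signed_sum xi t.
Proof.
by rewrite /signed_sum -sumrN; apply: eq_bigr => i _; rewrite mulrN.
Qed.

Lemma ler_norm_signed_sum xi t (B : R) :
  (forall i, `|t i| <= B) -> `|signed_sum xi t| <= B *+ m.
Proof.
move=> tB; apply: le_trans (ler_norm_sum _ _ _) _.
rewrite -[m in leRHS]card_ord -sumr_const; apply: ler_sum => i _.
by rewrite normrM normr_sign mul1r.
Qed.

Section suprema.
Context {X : Type} (S : set X).
Implicit Types u v : X -> 'I_m -> R.

Definition feature_bounded u := exists B, forall x i, S x -> `|u x i| <= B.

(** Without absolute values the contraction principle has constant 1. The family is indexed by [X]
    so that two features are compared at the same index. *)
Definition sup_signed xi u : R := sup [set signed_sum xi (u x) | x in S].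

Hypothesis S0 : S !=set0.

Lemma has_sup_signed xi u : feature_bounded u ->
  has_sup [set signed_sum xi (u x) | x in S].
Proof.
move=> [B uB]; split; first by case: S0 => x Sx; exists (signed_sum xi (u x)), x.
exists (B *+ m) => _ [x Sx <-]; apply: le_trans (ler_norm _) _.
by apply: ler_norm_signed_sum => i; exact: uB.
Qed.

Lemma sup_signed_ub xi u x : feature_bounded u -> S x ->
  signed_sum xi (u x) <= sup_signed xi u.
Proof.
move=> bu Sx; apply: ub_le_sup; first exact: (has_sup_signed xi bu).2.
by exists x.
Qed.

(** Only the terms at [i0] differ. Under a sign vector and its flip, two points x and y contribute
    v_x - v_y up to sign, which is at most |u_x - u_y|; this is what u contributes for (x, y) or for
    (y, x). *)
Lemma contraction_step (i0 : 'I_m) u v :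
  feature_bounded u -> feature_bounded v ->
  (forall x i, i != i0 -> v x i = u x i) ->
  (forall x y, `|v x i0 - v y i0| <= `|u x i0 - u y i0|) ->
  \sum_xi sup_signed xi v <= \sum_xi sup_signed xi u.
Proof.
move=> bu bv vu vu0.
(* Doubling the sum pairs every sign vector with its flip without choosing representatives. *)
have dbl w : (\sum_xi sup_signed xi w) *+ 2 =
    \sum_xi (sup_signed xi w + sup_signed (flip i0 xi) w).
  rewrite big_split mulr2n; congr (_ + _).
  by rewrite (reindex_inj (inv_inj (@flipK i0))).
rewrite -(ler_pMn2r (isT : (0 < 2)%N)) !dbl; apply: ler_sum => xi _.
rewrite -lerBrDr; apply: ge_sup => [|_ [x Sx <-]].
  exact: (has_sup_signed xi bv).1.
rewrite lerBrDl -lerBrDr; apply: ge_sup => [|_ [y Sy <-]].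
  exact: (has_sup_signed _ bv).1.
rewrite lerBrDl.
have ux := sup_signed_ub xi bu Sx; have uy := sup_signed_ub xi bu Sy.
have ux' := sup_signed_ub (flip i0 xi) bu Sx.
have uy' := sup_signed_ub (flip i0 xi) bu Sy.
have split w (z : X) eta : signed_sum eta (w z) =
    (-1) ^+ eta i0 * w z i0 + \sum_(i < m | i != i0) (-1) ^+ eta i * w z i.
  by rewrite /signed_sum (bigD1 i0).
have off w z : \sum_(i < m | i != i0) (-1) ^+ (flip i0 xi) i * w z i =
    \sum_(i < m | i != i0) (-1) ^+ xi i * w z i.
  by apply: eq_bigr => i /negbTE ii0; rewrite ffunE ii0.
have offv z : \sum_(i < m | i != i0) (-1) ^+ xi i * v z i =
    \sum_(i < m | i != i0) (-1) ^+ xi i * u z i.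
  by apply: eq_bigr => i ii0; rewrite vu.
have fl : (-1) ^+ (flip i0 xi) i0 = - (-1) ^+ xi i0 :> R.
  by rewrite ffunE eqxx; case: (xi i0); rewrite ?expr0 ?expr1 ?opprK.
move: ux uy ux' uy'; rewrite !split !off !offv fl.
have := vu0 x y; case: (xi i0); rewrite ?expr0 ?expr1 !(mulN1r, mul1r, opprK);
  case: (ltrgt0P (v x i0 - v y i0)); case: (ltrgt0P (u x i0 - u y i0));
  lra.
Qed.

(* Ledoux-Talagrand: the coordinates of u are replaced by those of v one at a
   time, pairing each sign vector with the one obtained by flipping the sign of
   that coordinate. *)
Lemma sup_signed_contraction u v :
  feature_bounded u -> feature_bounded v ->
  (forall x y i, `|v x i - v y i| <= `|u x i - u y i|) ->
  \sum_xi sup_signed xi v <= \sum_xi sup_signed xi u.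
Proof.
move=> bu bv vu.
pose w (k : nat) x (i : 'I_m) := if (i < k)%N then v x i else u x i.
have bw k : feature_bounded (w k).
  case: bu bv => B1 uB [B2 vB]; exists (Num.max B1 B2) => x i Sx.
  by rewrite /w le_max; case: ifP => _; rewrite ?uB ?vB ?orbT.
have wm : w m = v by apply/funext => x; apply/funext => i; rewrite /w ltn_ord.
suff wle k : (k <= m)%N ->
    \sum_xi sup_signed xi (w k) <= \sum_xi sup_signed xi u.
  by rewrite -wm; exact: wle.
elim: k => [_|k IH km].
  suff -> : w 0%N = u by [].
  by apply/funext => x; apply/funext => i; rewrite /w ltn0.
apply: le_trans (IH (ltnW km)).
apply: (@contraction_step (Ordinal km)) => //= x i.
  by rewrite /w ltnS leq_eqVlt => /negbTE; rewrite -val_eqE /= => ->.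
by rewrite /w /= ltnSn ltnn.
Qed.

End suprema.

(** * Absolutely convex hulls of ReLU images *)

Lemma ler_relu_dist (a b : R) : `|Num.max a 0 - Num.max b 0| <= `|a - b|.
Proof.
have h1 := ler_norm (a - b); have h2 := lerNnormlW (lexx `|a - b|).
rewrite ler_norml /Num.max; case: ltP => a0; case: ltP => b0; lra.
Qed.

Definition sup_abs T xi : R := sup [set `|signed_sum xi t| | t in T].

(* T carries the values, at the m sample points, of the units of a layer. The
   weights of a unit of the next layer, multiplied by the norms of the rows they
   are applied to, have l1 norm at most 1 by Hoelder's inequality. Distinct
   units may come from unrelated subnetworks, so the layer widths play no role. *)
Definition next_layer T : set ('I_m -> R) :=
  [set t | exists h (b : 'I_h -> R) (s : 'I_h -> 'I_m -> R),
    [/\ \sum_j `|b j| <= 1, (forall j, T (s j)) &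
        forall i, t i = \sum_j b j * Num.max (s j i) 0]].

(** Boundedness makes the real [sup] a true least upper bound; the zero vector makes one-sided
    suprema nonnegative. *)
Definition bounded_symmetric T :=
  [/\ T (fun=> 0), (forall t, T t -> T (fun i => - t i)) &
      exists B, forall t i, T t -> `|t i| <= B].

Lemma bounded_symmetric_next T :
  bounded_symmetric T -> bounded_symmetric (next_layer T).
Proof.
move=> [T0 TN [B TB]]; split.
- exists 0%N, (fun=> 0), (fun _ _ => 0); split => [|[]//|i]; by rewrite big_ord0.
- move=> t [h [b [s [b1 Ts tE]]]]; exists h, (fun j => - b j), s; split => //.
    by under eq_bigr do rewrite normrN.
  by move=> i; rewrite tE -sumrN; apply: eq_bigr => j _; rewrite mulNr.
- exists B => t i [h [b [s [b1 Ts ->]]]].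
  have B0 : 0 <= B by apply: le_trans (TB _ i T0); rewrite normr0.
  apply: le_trans (ler_norm_sum _ _ _) _.
  apply: (@le_trans _ _ (\sum_j `|b j| * B)).
    apply: ler_sum => j _; rewrite normrM ler_wpM2l//.
    have := ler_relu_dist (s j i) 0; rewrite maxxx !subr0 => /le_trans; apply.
    exact: TB.
  by rewrite -mulr_suml ler_piMl.
Qed.

Lemma sup_abs_ub T xi t : bounded_symmetric T -> T t ->
  `|signed_sum xi t| <= sup_abs T xi.
Proof.
move=> [_ _ [B TB]] Tt; apply: ub_le_sup; last by exists t.
exists (B *+ m) => _ [s Ts <-]; apply: ler_norm_signed_sum => i; exact: TB.
Qed.

Lemma sup_abs_le T xi (K : R) : T !=set0 ->
  (forall t, T t -> `|signed_sum xi t| <= K) -> sup_abs T xi <= K.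
Proof.
move=> [t0 Tt0] TK; apply: ge_sup; first by exists (`|signed_sum xi t0|), t0.
by move=> _ [t Tt <-]; exact: TK.
Qed.

(** On the hull, the absolute value of a signed sum is at most the larger of the one-sided suprema
    of relu(t) and -relu(t) over [T]. Both are nonnegative, so their sum is a bound; contraction
    applies to each, whence the factor 2. *)
Lemma sup_abs_next T : bounded_symmetric T ->
  \sum_xi sup_abs (next_layer T) xi <= 2 * \sum_xi sup_abs T xi.
Proof.
move=> bT; have [T0 TN [B TB]] := bT.
have [N0 _ _] := bounded_symmetric_next bT.
pose relut (t : 'I_m -> R) i := Num.max (t i) 0.
pose nrelut t i := - relut t i.
have Tn0 : T !=set0 by exists (fun=> 0).
have relu_bd t i : `|relut t i| <= `|t i|.
  by have := ler_relu_dist (t i) 0; rewrite maxxx !subr0.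
have bid : feature_bounded T id by exists B => t i; exact: TB.
have br : feature_bounded T relut.
  by exists B => t i Tt; apply: le_trans (relu_bd _ _) (TB _ _ Tt).
have bnr : feature_bounded T nrelut.
  by exists B => t i Tt; rewrite normrN; apply: le_trans (relu_bd _ _) (TB _ _ Tt).
have sum0 xi : signed_sum xi (fun=> 0) = 0.
  by rewrite /signed_sum big1// => i _; rewrite mulr0.
have relut0 : relut (fun=> 0) = fun=> 0.
  by apply/funext => i; rewrite /relut maxxx.
have nrelut0 : nrelut (fun=> 0) = fun=> 0.
  by apply/funext => i; rewrite /nrelut relut0 oppr0.
have r0 xi : 0 <= sup_signed T xi relut.
  by have := sup_signed_ub Tn0 xi br T0; rewrite relut0 sum0.
have nr0 xi : 0 <= sup_signed T xi nrelut.
  by have := sup_signed_ub Tn0 xi bnr T0; rewrite nrelut0 sum0.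
apply: (@le_trans _ _ (\sum_xi (sup_signed T xi relut + sup_signed T xi nrelut))).
  apply: ler_sum => xi _; apply: sup_abs_le; first by exists (fun=> 0).
  move=> t [h [b [s [b1 Ts tE]]]].
  set K := _ + _.
  have K0 : 0 <= K by rewrite addr_ge0.
  have -> : signed_sum xi t = \sum_j b j * signed_sum xi (relut (s j)).
    rewrite /signed_sum; under eq_bigr do rewrite tE mulr_sumr.
    rewrite exchange_big; apply: eq_bigr => j _; rewrite mulr_sumr.
    by apply: eq_bigr => i _; rewrite mulrCA.
  apply: le_trans (ler_norm_sum _ _ _) _.
  apply: (@le_trans _ _ (\sum_j `|b j| * K)); last by rewrite -mulr_suml ler_piMl.
  apply: ler_sum => j _; rewrite normrM ler_wpM2l// ler_norml.
  have := sup_signed_ub Tn0 xi bnr (Ts j); rewrite signed_sumN.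
  have := sup_signed_ub Tn0 xi br (Ts j).
  by have := r0 xi; have := nr0 xi; rewrite /K; lra.
rewrite big_split mulr_natl mulr2n.
have le_abs : \sum_xi sup_signed T xi id <= \sum_xi sup_abs T xi.
  apply: ler_sum => xi _; apply: ge_sup; first exact: (has_sup_signed Tn0 xi bid).1.
  by move=> _ [t Tt <-]; apply: le_trans (ler_norm _) (sup_abs_ub xi bT Tt).
apply: lerD; apply: le_trans le_abs; apply: sup_signed_contraction => // t s i.
  exact: ler_relu_dist.
by rewrite /nrelut -opprD normrN ler_relu_dist.
Qed.

Lemma sup_abs_iter T k : bounded_symmetric T ->
  bounded_symmetric (iter k next_layer T) /\
  \sum_xi sup_abs (iter k next_layer T) xi <= 2 ^+ k * \sum_xi sup_abs T xi.
Proof.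
move=> bT; elim: k => [|k [bk IH]]; first by rewrite expr0 mul1r.
split; first exact: bounded_symmetric_next.
rewrite iterS; apply: le_trans (sup_abs_next bk) _.
by rewrite exprS -mulrA ler_wpM2l.
Qed.

(** Dividing the coefficients by [C] puts the combination in the hull. If [C] is not positive, all
    coefficients vanish and the zero vector serves. *)
Lemma next_layer_scale T h (b : 'I_h -> R) (s : 'I_h -> 'I_m -> R) (C : R) :
  bounded_symmetric T -> (forall j, T (s j)) -> \sum_j `|b j| <= C ->
  exists2 t, next_layer T t &
    forall i, \sum_j b j * Num.max (s j i) 0 = C * t i.
Proof.
move=> bT Ts bC.
have [C0|C0] := ltP 0 C.
  exists (fun i => \sum_j (b j / C) * Num.max (s j i) 0).
    exists h, (fun j => b j / C), s; split => //.
    under eq_bigr do rewrite normrM normfV (gtr0_norm C0).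
    by rewrite -mulr_suml ler_pdivrMr// mul1r.
  move=> i; rewrite mulr_sumr; apply: eq_bigr => j _.
  by rewrite mulrA mulrCA divff ?mulr1// gt_eqF.
have b0 j : b j = 0.
  apply/eqP; rewrite -normr_le0.
  apply: le_trans (le_trans bC C0).
  by rewrite (bigD1 j)//= lerDl sumr_ge0.
exists (fun=> 0); first by case: (bounded_symmetric_next bT).
by move=> i; rewrite mulr0 big1// => j _; rewrite b0 mul0r.
Qed.

End signed_sums.

(** * Networks *)

Section networks.
Context {R : realType} {m n : nat} (x : 'I_m -> 'cV[R]_n) (p : R) (q : \bar R).
Hypotheses (p1 : 1 <= p) (q1 : (1 <= q)%E)
  (qp : (q <= hoelder_conjugate p%:E)%E).

Definition linear_outputs : set ('I_m -> R) :=
  [set t | exists2 v : 'cV[R]_n, vnorm p%:E v <= 1 &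
           forall i, t i = \sum_j v j 0 * x i j 0].

Lemma bounded_symmetric_linear : bounded_symmetric linear_outputs.
Proof.
have p1E : (1 <= p%:E)%E by rewrite lee_fin.
split.
- exists 0 => [|i]; last by rewrite big1// => j _; rewrite mxE mul0r.
  rewrite /vnorm (_ : lpnorm _ _ = lpnorm p%:E (fun j : 'I_n => 0 * 0 : R)).
    by rewrite lpnormZ// normr0 mul0r.
  by congr lpnorm; apply/funext => j; rewrite mxE mul0r.
- move=> t [v v1 tE]; exists (- v) => [|i].
    rewrite /vnorm (_ : (fun j => _) = (fun j => -1 * v j 0)).
      by rewrite lpnormZ// normrN1 mul1r.
    by apply/funext => j; rewrite mxE mulN1r.
  by rewrite tE -sumrN; apply: eq_bigr => j _; rewrite mxE mulNr.
(* Any finite bound serves; each [|v j 0|] is at most the norm of [v], hence at most 1. *)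
- exists (\sum_i \sum_j `|x i j 0|) => t i [v v1 ->].
  apply: (@le_trans _ _ (\sum_j `|x i j 0|)).
    apply: le_trans (ler_norm_sum _ _ _) _; apply: ler_sum => j _.
    rewrite normrM ler_piMl//; apply: le_trans v1.
    exact: (ler_lpnorm (fun j => v j 0)).
  rewrite [leRHS](bigD1 i)//= lerDl; apply: sumr_ge0 => k _.
  exact: sumr_ge0.
Qed.

(** Every unit is a scale times a vector of [T]; nonnegative scales pass through the ReLU. They are
    measured in the l_q norm, the outer norm of [mxnorm]. *)
Definition layer_rep (T : set ('I_m -> R)) (c : R) (h : nat)
    (Z : 'I_m -> 'cV[R]_h) :=
  exists (a : 'I_h -> R) (s : 'I_h -> 'I_m -> R),
    [/\ forall j, 0 <= a j, forall j, T (s j),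
        forall i j, Z i j 0 = a j * s j i & lpnorm q a <= c].

(** The scale of a unit is the l_p norm of its row. *)
Lemma layer_rep_linear (h : nat) (W : 'M[R]_(h, n)) :
  layer_rep linear_outputs (mxnorm p%:E q W) (fun i => W *m x i).
Proof.
have p1E : (1 <= p%:E)%E by rewrite lee_fin.
exists (fun j => lpnorm p%:E (W j)).
exists (fun j i => \sum_k (lpnorm p%:E (W j))^-1 * W j k * x i k 0).
split=> [j|j|i j|//]; first exact: lpnorm_ge0.
- exists (\col_k ((lpnorm p%:E (W j))^-1 * W j k)) => [|i].
    rewrite /vnorm (_ : (fun k => _) = (fun k => (lpnorm p%:E (W j))^-1 * W j k)).
      rewrite lpnormZ// ger0_norm ?invr_ge0 ?lpnorm_ge0//.
      have [->|W0] := eqVneq (lpnorm p%:E (W j)) 0; first by rewrite mulr0.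
      by rewrite mulVf.
    by apply/funext => k; rewrite mxE.
  by apply: eq_bigr => k _; rewrite mxE.
- rewrite mxE mulr_sumr; apply: eq_bigr => k _; rewrite 2!mulrA.
  (* A row of norm zero has only zero entries, so both sides vanish. *)
  have [W0|W0] := eqVneq (lpnorm p%:E (W j)) 0; last by rewrite divff// mul1r.
  suff -> : W j k = 0 by rewrite mulr0.
  by apply/eqP; rewrite -normr_le0 -W0 ler_lpnorm.
Qed.

(** Since relu(a s) = a relu(s) for a >= 0, row r combines the vectors relu(s_j) with coefficients
    W_rj a_j. By Hoelder their l_1 norm is at most |W_r|_p |a|_{p^*}, and |a|_{p^*} <= |a|_q <= c
    because q <= p^*. The new scales are c |W_r|_p. *)
Lemma layer_rep_next (T : set ('I_m -> R)) (c : R) (h h' : nat)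
    (W : 'M[R]_(h', h)) (Z : 'I_m -> 'cV[R]_h) :
  bounded_symmetric T -> layer_rep T c Z ->
  layer_rep (next_layer T) (c * mxnorm p%:E q W) (fun i => W *m relu (Z i)).
Proof.
move=> bT [a [s [a0 Ts Zs ac]]].
have c0 : 0 <= c by apply: le_trans ac; exact: lpnorm_ge0.
have Wa r : \sum_j `|W r j * a j| <= c * lpnorm p%:E (W r).
  under eq_bigr do rewrite normrM.
  apply: le_trans (hoelder_sum _ _ p1) _.
  rewrite mulrC ler_wpM2r ?lpnorm_ge0//; apply: le_trans ac.
  exact: le_lpnorm.
have /choice[t tP] r : exists t, next_layer T t /\
    forall i, \sum_j W r j * a j * Num.max (s j i) 0 = c * lpnorm p%:E (W r) * t i.
  by have [t] := next_layer_scale bT Ts (Wa r); exists t.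
exists (fun r => c * lpnorm p%:E (W r)), t; split.
- by move=> r; rewrite mulr_ge0// lpnorm_ge0.
- by move=> r; exact: (tP r).1.
- move=> i r; rewrite -(tP r).2 mxE; apply: eq_bigr => j _.
  by rewrite /relu mxE Zs -mulrA (maxr_pMr _ _ (a0 j)) mulr0.
- by rewrite lpnormZ// ger0_norm.
Qed.

Lemma layer_rep_foldl (T : set ('I_m -> R)) (c : R) (h : nat)
    (Ws : seq 'M[R]_h) (Z : 'I_m -> 'cV[R]_h) :
  bounded_symmetric T -> layer_rep T c Z ->
  layer_rep (iter (size Ws) next_layer T) (c * \prod_(W <- Ws) mxnorm p%:E q W)
    (fun i => foldl (fun z W => W *m relu z) (Z i) Ws).
Proof.
elim: Ws T c Z => [|W Ws IH] T c Z bT rZ; first by rewrite big_nil mulr1.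
rewrite big_cons mulrA [size _]/= iterSr; apply: IH.
  exact: bounded_symmetric_next.
exact: layer_rep_next.
Qed.

(** The output layer has a single unit, whose scale is at most the product of the layer norms. A
    network of depth d applies the ReLU d - 1 times. *)
Lemma net_signed_sum (h d : nat) (w : network R n h d) xi :
  `|signed_sum xi (fun i => net_fun w (x i))| <=
  net_psi p%:E q w * sup_abs (iter d.-1 next_layer linear_outputs) xi.
Proof.
have out T c (Z : 'I_m -> 'cV[R]_1) : bounded_symmetric T -> layer_rep T c Z ->
    `|signed_sum xi (fun i => Z i 0 0)| <= c * sup_abs T xi.
  move=> bT [a [s [a0 Ts Zs ac]]].
  have -> : signed_sum xi (fun i => Z i 0 0) = a 0 * signed_sum xi (s 0).
    rewrite mulr_sumr; apply: eq_bigr => i _.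
    by rewrite Zs mulrCA.
  rewrite normrM ler_pM//; last exact: sup_abs_ub.
  by apply: le_trans ac; exact: ler_lpnorm.
have bL := bounded_symmetric_linear.
have -> : net_psi p%:E q w = \prod_(y <- layer_norms p%:E q w) y.
  by rewrite big_tuple.
case: w => [W|k W1 Ws Wd] /=.
  rewrite big_seq1; apply: (out _ _ (fun i => W *m x i)) => //.
  exact: layer_rep_linear.
rewrite big_cons big_rcons big_map /=.
have [bk _] := sup_abs_iter k bL.
apply: (out _ _ (fun i => Wd *m relu (foldl _ (W1 *m x i) Ws))).
  exact: bounded_symmetric_next.
rewrite mulrA; apply: layer_rep_next => //.
rewrite -{1}(size_tuple Ws); apply: layer_rep_foldl => //.
exact: layer_rep_linear.
Qed.

Lemma layer_norms_ge0 (h d : nat) (w : network R n h d) k :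
  0 <= tnth (layer_norms p%:E q w) k.
Proof.
suff /allP : all (fun y => 0 <= y) (layer_norms p%:E q w).
  by apply; exact: mem_tnth.
have mx0 a b (W : 'M[R]_(a, b)) : 0 <= mxnorm p%:E q W by exact: lpnorm_ge0.
case: w {k} => [W|k W1 Ws Wd] /=; first by rewrite mx0.
by rewrite all_rcons !mx0/=; apply/allP => _ /mapP[W _ ->].
Qed.

End networks.

(** AM-GM for the numbers N_k^q. For infinite q, 1/q is 0 and each factor is at most the maximum. *)
Lemma prod_le_lpnorm (R : realType) (q : \bar R) (d : nat) (N : 'I_d -> R) :
  (0 < d)%N -> (1 <= q)%E -> (forall k, 0 <= N k) ->
  \prod_k N k <= (lpnorm q N / d%:R `^ fine q^-1%E) ^+ d.
Proof.
move=> d0 q1 N0.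
case: q q1 => [r|_|//]; last first.
  rewrite invey powRr0 divr1.
  have -> (y : R) : y ^+ d = \prod_(k < d) y by rewrite prodr_const card_ord.
  apply: ler_prod => k _; rewrite N0 /=.
  by rewrite -[leLHS]ger0_norm//; apply: (@ler_lpnorm _ +oo%E); exact: leey.
rewrite lee_fin => r1; have r0 : 0 < r by exact: lt_le_trans r1.
rewrite inver gt_eqF//= -[X in (X / _)]/(lpnorm r%:E N).
have dr0 : 0 < d%:R `^ r^-1 :> R by apply: powR_gt0; rewrite ltr0n.
have rhs0 : 0 <= lpnorm r%:E N / d%:R `^ r^-1.
  by rewrite divr_ge0 ?lpnorm_ge0// ltW.
apply: (powR_le_inj r0); rewrite ?prodr_ge0 ?exprn_ge0//.
have swap (y : R) : 0 <= y -> (y ^+ d) `^ r = (y `^ r) ^+ d.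
  move=> y0; rewrite -(powR_mulrn d y0) -powRrM mulrC powRrM.
  by rewrite powR_mulrn ?powR_ge0.
rewrite swap//.
have -> : (lpnorm r%:E N / d%:R `^ r^-1) `^ r = (\sum_k N k `^ r) / d%:R.
  rewrite powRM ?lpnorm_ge0 ?invr_ge0 ?(ltW dr0)// lpnorm_powR//; congr (_ * _).
    by apply: eq_bigr => k _; rewrite ger0_norm.
  rewrite -powR_inv1 ?(ltW dr0)// -[RHS]powR_inv1// -!powRrM.
  by congr powR; field; rewrite gt_eqF.
have -> : (\prod_k N k) `^ r = \prod_k (N k `^ r).
  have [_ ->] // : 0 <= \prod_k N k /\ (\prod_k N k) `^ r = \prod_k (N k `^ r).
  elim/big_rec2 : _ => [|k y1 y2 _ [y20 <-]]; first by rewrite powR1.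
  by rewrite mulr_ge0// powRM.
have := (@leif_AGM _ _ (mem 'I_d) (fun k => N k `^ r) _).1.
by rewrite card_ord; apply => k _; exact: powR_ge0.
Qed.

(** * Moments of signed sums *)

(** This compares x^(2k) / (2k)! with (x^2 / 2)^k / k!. *)
Lemma leq_exp2_fact_double (k : nat) : (2 ^ k * k`! <= (k.*2)`!)%N.
Proof.
elim: k => // k IH; rewrite doubleS !factS expnS.
rewrite (_ : (2 * 2 ^ k * (k.+1 * k`!) = k.+1.*2 * (2 ^ k * k`!))%N); last first.
  by rewrite -mul2n mulnACA mulnA.
rewrite doubleS leq_mul//; apply: leq_trans IH _.
by rewrite leq_pmull.
Qed.

Section cosh.
Import numFieldNormedType.Exports.

(** In the power series on the left the odd terms cancel, and the even ones are compared with those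
    of the exponential on the right. *)
Lemma cosh_le_expR_sqr (R : realType) (x : R) :
  expR x + expR (- x) <= 2 * expR (x ^+ 2 / 2).
Proof.
set z := x ^+ 2 / 2.
have z0 : 0 <= z by rewrite divr_ge0// sqr_ge0.
pose f : R ^nat := fun k => exp_coeff x k + exp_coeff (- x) k.
have fE k : f k = if odd k then 0 else 2 * (x ^+ k / k`!%:R).
  rewrite /f /exp_coeff /=.
  case: ifP => k_odd.
    by rewrite exprNn -signr_odd k_odd expr1 mulN1r mulNr subrr.
  by rewrite exprNn -signr_odd k_odd expr0 mul1r mulr_natl mulr2n.
have f0 k : 0 <= f k.
  rewrite fE; case: ifP => // /negbT/even_halfK <-.
  by rewrite -muln2 mulnC exprM mulr_ge0// divr_ge0// exprn_ge0// sqr_ge0.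
have cx := is_cvg_series_exp_coeff x; have cNx := is_cvg_series_exp_coeff (- x).
pose S : R ^nat := fun N => series (exp_coeff x) N + series (exp_coeff (- x)) N.
have SE N : S N = series f N by rewrite /S /series /= big_split.
have -> : expR x + expR (- x) = limn S by apply/esym/limD.
apply: limr_le; first exact: is_cvgD.
apply: nearW => N; rewrite SE.
have partial_sum k : series (exp_coeff z) k <= expR z.
  apply: nondecreasing_cvgn_le; last exact: is_cvg_series_exp_coeff.
  by apply/nondecreasing_seqP => j; rewrite /series/= big_nat_recr//= lerDl exp_coeff_ge0.
apply: (@le_trans _ _ (2 * series (exp_coeff z) N)); last by rewrite ler_wpM2l.
(* The terms are nonnegative, so the partial sum may be extended to 2N terms, which match N terms of
   the series of exp(z). *)
apply: (@le_trans _ _ (series f N.*2)).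
  have NN : (N <= N.*2)%N by rewrite -addnn leq_addr.
  rewrite /series /= [leRHS](big_cat_nat (n := N))//=.
  by rewrite lerDl sumr_ge0.
elim: N => [|N IH]; first by rewrite /series /= !big_geq// mulr0.
rewrite doubleS /series /= !big_nat_recr//= mulrDr; move: IH.
rewrite /series /= => IH; rewrite -addrA lerD//.
rewrite !fE /= odd_double /= addr0 ler_wpM2l// /exp_coeff /= -muln2 mulnC exprM.
rewrite /z expr_div_n -mulrA; apply: ler_wpM2l.
  by apply: exprn_ge0; exact: sqr_ge0.
rewrite -invfM lef_pV2 ?posrE ?mulr_gt0 ?exprn_gt0 ?ltr0n ?fact_gt0//.
by rewrite -natrX -natrM ler_nat mul2n leq_exp2_fact_double.
Qed.

End cosh.

Section moments.
Context {R : realType} {m : nat}.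
Implicit Types (a : 'I_m -> R).

(** The sum over all sign vectors factors into a product over the coordinates of e^(a_i) +
    e^(-a_i). *)
Lemma sum_expR_signed_sum a :
  \sum_xi expR (signed_sum xi a) <= 2 ^+ m * expR ((\sum_i a i ^+ 2) / 2).
Proof.
pose F (i : 'I_m) (b : bool) := expR ((-1) ^+ b * a i).
have -> : \sum_xi expR (signed_sum xi a) = \prod_i \sum_b F i b.
  rewrite bigA_distr_bigA; apply: eq_bigr => xi _.
  by rewrite /signed_sum expR_sum.
have -> : 2 ^+ m * expR ((\sum_i a i ^+ 2) / 2) =
    \prod_i (2 * expR (a i ^+ 2 / 2)).
  by rewrite big_split prodr_const card_ord mulr_suml expR_sum.
apply: ler_prod => i _; rewrite sumr_ge0//=; last by move=> b _; exact: expR_ge0.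
rewrite big_bool /F /= expr1 expr0 mul1r mulN1r addrC.
exact: cosh_le_expR_sqr.
Qed.

(** This is the r-th power of y/r <= exp(y/r - 1). *)
Lemma powR_le_expR (r y : R) : 0 < r -> 0 <= y ->
  y `^ r <= r `^ r * expR (y - r).
Proof.
move=> r0 y0; have -> : expR (y - r) = expR (y / r - 1) `^ r.
  by rewrite -expRM; congr expR; field; rewrite gt_eqF.
rewrite -powRM ?expR_ge0 ?(ltW r0)//.
apply: ge0_ler_powR; rewrite ?nnegrE ?mulr_ge0 ?expR_ge0 ?(ltW r0)//.
rewrite mulrC -ler_pdivrMr//.
by apply: le_trans (expR_ge1Dx _); rewrite addrC subrK.
Qed.

(* powR_le_expR with y = l |S|, at the optimal l = sqrt (r / sum_i a_i^2). *)
Lemma moment_signed_sum a (r : R) : 0 < r ->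
  \sum_xi `|signed_sum xi a| `^ r <=
  2 ^+ m.+1 * (r * (\sum_i a i ^+ 2) * expR (-1)) `^ (r / 2).
Proof.
move=> r0; set V := \sum_i a i ^+ 2.
have V0 : 0 <= V by apply: sumr_ge0 => i _; exact: sqr_ge0.
have rhs0 : 0 <= 2 ^+ m.+1 * (r * V * expR (-1)) `^ (r / 2).
  by rewrite mulr_ge0 ?exprn_ge0 ?powR_ge0.
have [V_eq0|V_neq0] := eqVneq V 0.
  have a0 i : a i = 0.
    apply/eqP; rewrite -sqrf_eq0 -(@psumr_eq0P _ _ xpredT _ _ V_eq0 i)//.
    by move=> j _; exact: sqr_ge0.
  rewrite big1// => xi _; rewrite /signed_sum big1 ?normr0 ?powR0 ?gt_eqF//.
  by move=> i _; rewrite a0 mulr0.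
have Vgt0 : 0 < V by rewrite lt0r V_neq0.
pose l := Num.sqrt (r / V).
have l2 : l ^+ 2 = r / V by rewrite sqr_sqrtr// divr_ge0// ltW.
have l0 : 0 < l by rewrite sqrtr_gt0 divr_gt0.
have lr0 : 0 < l `^ r by exact: powR_gt0.
have half (u : R) : 0 <= u -> u `^ r = (u ^+ 2) `^ (r / 2).
  by move=> u0; rewrite -powR_mulrn// -powRrM; congr powR; field.
rewrite -(ler_pM2l lr0) mulr_sumr.
have scale xi : l * signed_sum xi a = signed_sum xi (fun i => l * a i).
  by rewrite /signed_sum mulr_sumr; apply: eq_bigr => i _; rewrite mulrCA.
(* Here exp|u| <= exp(u) + exp(-u) removes the absolute value; the two sums give the extra factor 2
   in [2 ^+ m.+1]. *)
apply: (@le_trans _ _ (\sum_xi r `^ r * expR (- r) *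
    (expR (signed_sum xi (fun i => l * a i)) +
     expR (signed_sum xi (fun i => - (l * a i)))))).
  apply: ler_sum => xi _; rewrite -powRM// ?(ltW l0)//.
  rewrite signed_sumN -!scale.
  have -> : l * `|signed_sum xi a| = `|l * signed_sum xi a|.
    by rewrite normrM gtr0_norm.
  apply: le_trans (powR_le_expR r0 (normr_ge0 _)) _.
  rewrite -mulrA ler_wpM2l ?powR_ge0// [_ - r]addrC expRD ler_wpM2l ?expR_ge0//.
  by case: (ger0P (l * _)) => _; rewrite ?lerDl ?lerDr expR_ge0.
rewrite -mulr_sumr big_split /=.
apply: (@le_trans _ _ (r `^ r * expR (- r) * (2 ^+ m.+1 * expR (r / 2)))).
  rewrite ler_wpM2l ?mulr_ge0 ?powR_ge0 ?expR_ge0//.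
  rewrite exprS -mulrA mulr_natl mulr2n.
  have sq : \sum_i (l * a i) ^+ 2 = r.
    under eq_bigr do rewrite exprMn.
    by rewrite -mulr_sumr l2 -mulrA mulVf// mulr1.
  have sqN : \sum_i (- (l * a i)) ^+ 2 = r by under eq_bigr do rewrite sqrrN.
  apply: lerD.
    by have := sum_expR_signed_sum (fun i => l * a i); rewrite sq.
  by have := sum_expR_signed_sum (fun i => - (l * a i)); rewrite sqN.
(* Both sides equal 2^(m+1) r^r e^(-r/2), because l^2 V = r. *)
rewrite le_eqVlt; apply/orP; left; apply/eqP.
rewrite mulrCA [RHS]mulrCA; congr (_ * _).
rewrite !half ?(ltW l0) ?(ltW r0)// l2 -powRM ?mulr_ge0 ?invr_ge0 ?expR_ge0 ?(ltW r0)//.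
have -> : r / V * (r * V * expR (-1)) = r ^+ 2 * expR (-1).
  by field.
rewrite powRM ?sqr_ge0 ?expR_ge0// -mulrA -expRD; congr (_ * _).
by rewrite -expRM; congr expR; field.
Qed.

(** Jensen's inequality from the tangent at the mean u: t^s >= u^s (1 + s (t/u - 1)), where the
    terms t/u - 1 sum to zero. *)
Lemma powR_mean (I : finType) (s : R) (t : I -> R) :
  1 <= s -> (0 < #|I|)%N -> (forall i, 0 <= t i) ->
  (#|I|%:R^-1 * \sum_i t i) `^ s <= #|I|%:R^-1 * \sum_i t i `^ s.
Proof.
move=> s1 I0 t0; have s0 : 0 < s by exact: lt_le_trans s1.
have N0 : 0 < #|I|%:R :> R by rewrite ltr0n.
set u := _^-1 * \sum_i t i.
have u0 : 0 <= u by rewrite mulr_ge0 ?invr_ge0 ?(ltW N0)// sumr_ge0.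
have sum_t : \sum_i t i = u * #|I|%:R.
  by rewrite /u mulrAC mulVf ?mul1r// gt_eqF.
have [->|u_neq0] := eqVneq u 0.
  rewrite powR0 ?gt_eqF// mulr_ge0 ?invr_ge0 ?(ltW N0)//.
  by apply: sumr_ge0 => i _; exact: powR_ge0.
clearbody u; have ugt0 : 0 < u by rewrite lt0r u_neq0.
(* Bernoulli's inequality is Young's inequality for y and 1; at s = 1 it is an equality. *)
have bernoulli (y : R) : 0 <= y -> 1 + s * (y - 1) <= y `^ s.
  move=> y0; move: s1; rewrite le_eqVlt => /predU1P[<-|s1].
    by rewrite powRr1// mul1r addrC subrK.
  have q0 : 0 < s / (s - 1) by rewrite divr_gt0 ?subr_gt0.
  have sq : s^-1 + (s / (s - 1))^-1 = 1 by field; lra.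
  have := conjugate_powR y0 ler01 s0 q0 sq; rewrite powR1 mulr1.
  rewrite -(ler_pM2l s0) mulrDr mulrCA divff ?gt_eqF// mulr1.
  rewrite (_ : s * (1 / (s / (s - 1))) = s - 1); first by lra.
  by field; lra.
rewrite mulrC ler_pdivlMr//.
have -> : u `^ s * #|I|%:R = \sum_i u `^ s * (1 + s * (t i / u - 1)).
  rewrite -mulr_sumr; congr (_ * _).
  rewrite big_split /= sumr_const -mulr_sumr big_split /= -mulr_suml sumr_const.
  rewrite sum_t.
  by rewrite mulrAC divff// mul1r mulNrn subrr mulr0 addr0.
apply: ler_sum => i _; have tE : t i = u * (t i / u) by rewrite mulrC mulfVK.
rewrite [in leRHS]tE powRM ?divr_ge0// ler_wpM2l ?powR_ge0//.
by apply: bernoulli; rewrite divr_ge0.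
Qed.

End moments.

(** * The linear class *)

Section linear_bound.
Context {R : realType} {m n : nat} (x : 'I_m -> 'cV[R]_n) (p : R).
Hypotheses (m_gt0 : (0 < m)%N) (p1 : 1 <= p).

Let y xi (j : 'I_n) : R := signed_sum xi (fun i => x i j 0).

(** The signed sum of the values of v is its pairing with [y xi]. Hoelder bounds it by the l_{p^*}
    norm, which is at most the l_r norm as r <= p^*. *)
Lemma sup_abs_linear_le_lpnorm xi (r : R) :
  1 <= r -> (r%:E <= hoelder_conjugate p%:E)%E ->
  sup_abs (linear_outputs x p) xi <= lpnorm r%:E (y xi).
Proof.
move=> r1 rp; apply: sup_abs_le.
  by have [L0 _ _] := bounded_symmetric_linear x p1; exists (fun=> 0).
move=> t [v v1 tE].
have -> : signed_sum xi t = \sum_j v j 0 * y xi j.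
  rewrite /signed_sum; under eq_bigr do rewrite tE mulr_sumr.
  rewrite exchange_big; apply: eq_bigr => j _; rewrite mulr_sumr.
  by apply: eq_bigr => i _; rewrite mulrCA.
apply: le_trans (ler_norm_sum _ _ _) _.
under eq_bigr do rewrite normrM.
apply: le_trans (hoelder_sum (fun j => v j 0) (y xi) p1) _.
apply: (@le_trans _ _ (1 * lpnorm (hoelder_conjugate p%:E) (y xi))).
  by rewrite ler_wpM2r ?lpnorm_ge0.
by rewrite mul1r le_lpnorm.
Qed.

(** Jensen passes to the mean of the r-th power of the l_r norm, which splits into moments of single
    coordinates. The hypothesis on [M] is shaped so that e^(r/2) offsets the e^(-r/2) of the moment
    bound, which thus pays for its factor 2. *)
Lemma mean_sup_abs_linear_le (r M : R) :
  2 <= r -> (r%:E <= hoelder_conjugate p%:E)%E -> 0 <= M ->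
  (forall i, 2 * \sum_j `|x i j 0| `^ r <= expR (r / 2) * M `^ r) ->
  (2 ^+ m)^-1 * \sum_xi sup_abs (linear_outputs x p) xi <=
  Num.sqrt (r * m%:R) * M.
Proof.
move=> r2 rp M0 xM.
have r0 : 0 < r by exact: lt_le_trans r2.
have r1 : 1 <= r by apply: le_trans r2; rewrite ler1n.
have mR0 : 0 < m%:R :> R by rewrite ltr0n.
have c0 : 0 <= (2 ^+ m)^-1 :> R by rewrite invr_ge0 exprn_ge0.
have card_signs : #|{: {ffun 'I_m -> bool}}|%:R = 2 ^+ m :> R.
  by rewrite card_ffun card_bool card_ord natrX.
apply: (@le_trans _ _ ((2 ^+ m)^-1 * \sum_xi lpnorm r%:E (y xi))).
  by rewrite ler_wpM2l//; apply: ler_sum => xi _; exact: sup_abs_linear_le_lpnorm.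
apply: (powR_le_inj r0).
- by rewrite mulr_ge0// sumr_ge0// => xi _; exact: lpnorm_ge0.
- by rewrite mulr_ge0// sqrtr_ge0.
have jensen := @powR_mean _ _ r (fun xi => lpnorm r%:E (y xi)) r1.
rewrite card_signs in jensen; apply: le_trans (jensen _ _) _.
- by rewrite card_ffun card_bool card_ord expn_gt0.
- by move=> xi; exact: lpnorm_ge0.
under eq_bigr do rewrite lpnorm_powR//.
rewrite exchange_big /=.
pose V j := \sum_(i < m) x i j 0 ^+ 2.
pose C := (r * expR (-1)) `^ (r / 2).
have C0 : 0 <= C by exact: powR_ge0.
have re0 : 0 <= r * expR (-1) by rewrite mulr_ge0 ?expR_ge0 ?(ltW r0).
have V0 j : 0 <= V j by apply: sumr_ge0 => i _; exact: sqr_ge0.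
(* Power mean inequality for the squares with exponent r/2, which is at least 1 since r >= 2. *)
have VE j : V j `^ (r / 2) <= m%:R `^ (r / 2) * (m%:R^-1 * \sum_i `|x i j 0| `^ r).
  have r21 : 1 <= r / 2 by rewrite ler_pdivlMr// mul1r.
  have := @powR_mean _ 'I_m (r / 2) (fun i => x i j 0 ^+ 2) r21.
  rewrite card_ord => /(_ m_gt0 (fun i => sqr_ge0 _)).
  rewrite -/(V j).
  have sqE i : (x i j 0 ^+ 2) `^ (r / 2) = `|x i j 0| `^ r.
    rewrite -(real_normK (num_real _)) -powR_mulrn// -powRrM; congr powR.
    by field.
  rewrite (eq_bigr _ (fun i _ => sqE i)).
  move=> /(ler_wpM2l (powR_ge0 m%:R (r / 2))); apply: le_trans.
  rewrite -powRM ?mulr_ge0 ?invr_ge0 ?ler0n//.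
  by rewrite mulrA divff ?mul1r// gt_eqF.
apply: (@le_trans _ _ (2 * C * \sum_j V j `^ (r / 2))).
  rewrite mulrC ler_pdivrMr ?exprn_gt0// mulrAC mulr_sumr.
  apply: ler_sum => j _.
  apply: le_trans (moment_signed_sum _ r0) _.
  rewrite -/(V j) (_ : r * V j * expR (-1) = r * expR (-1) * V j); last by ring.
  by rewrite (powRM _ re0 (V0 j)) -/C exprS le_eqVlt; apply/orP; left; apply/eqP; ring.
apply: (@le_trans _ _ (C * m%:R `^ (r / 2) * (m%:R^-1 *
    \sum_(i < m) (2 * \sum_j `|x i j 0| `^ r)))).
  rewrite -[2 * C]mulrC -!mulrA ler_wpM2l// -mulr_sumr.
  rewrite exchange_big /= [leRHS](_ : _ =
    2 * \sum_j (m%:R `^ (r / 2) * (m%:R^-1 * \sum_i `|x i j 0| `^ r))).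
    by rewrite ler_wpM2l//; apply: ler_sum.
  by rewrite -!mulr_sumr; ring.
apply: (@le_trans _ _ (C * m%:R `^ (r / 2) * (expR (r / 2) * M `^ r))).
  rewrite ler_wpM2l ?mulr_ge0 ?powR_ge0// ler_pdivrMl//.
  rewrite mulr_natl -[m in leRHS]card_ord -sumr_const.
  exact: ler_sum.
rewrite le_eqVlt; apply/orP; left; apply/eqP.
rewrite [RHS]powRM ?sqrtr_ge0//.
rewrite -powR12_sqrt ?mulr_ge0 ?(ltW r0) ?(ltW mR0)// -powRrM.
rewrite mulrA; congr (_ * _).
rewrite [2^-1 * r]mulrC powRM ?(ltW r0) ?(ltW mR0)//.
rewrite /C powRM ?expR_ge0 ?(ltW r0)// -expRM.
rewrite mulrAC; congr (_ * _); rewrite -mulrA -expRD mulN1r addNr expR0 mulr1//.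
Qed.

End linear_bound.

(** * The exponent min(p^*, 4 log(2n)) *)

Lemma hoelder_conjugate_ge2 (R : realType) (p : R) :
  1 <= p <= 2 -> (2%:E <= hoelder_conjugate p%:E)%E.
Proof.
move=> /andP[]; rewrite le_eqVlt => /predU1P[<- _|p1 p2].
  by rewrite hoelder_conjugate1 leey.
rewrite hoelder_conjugate_fin// lee_fin ler_pdivlMr ?subr_gt0//; lra.
Qed.

(* If the minimum is pstar, the bound on the r-th powers is 2 <= e^(r/2);
   otherwise e^(r/2) = (2n)^2, which absorbs the factor 2n lost by bounding each
   coordinate by the l_pstar norm. *)
Lemma log_exponent (R : realType) (n : nat) (p : R) : (0 < n)%N -> 1 <= p <= 2 ->
  exists r : R,
    [/\ Order.min (hoelder_conjugate p%:E) (4 * ln (2 * n%:R))%:E = r%:E,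
        2 <= r, (r%:E <= hoelder_conjugate p%:E)%E &
        forall (v : 'cV[R]_n) M, vnorm (hoelder_conjugate p%:E) v <= M ->
          2 * \sum_j `|v j 0| `^ r <= expR (r / 2) * M `^ r].
Proof.
move=> n0 p12; have ps2 := hoelder_conjugate_ge2 p12.
have n1 : 1 <= n%:R :> R by rewrite ler1n.
have two_n0 : 0 < 2 * n%:R :> R by lra.
case: (leP (hoelder_conjugate p%:E) (4 * ln (2 * n%:R))%:E) => psL.
  have [r psE] : exists r : R, hoelder_conjugate p%:E = r%:E.
    case: (hoelder_conjugate p%:E) ps2 psL => [r _ _||]; first by exists r.
    - by rewrite leye_eq.
    - by rewrite leeNy_eq.
  exists r; rewrite psE lee_fin in ps2 *; split=> // v M vM.
  have r0 : 0 < r by exact: lt_le_trans ps2.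
  rewrite -(lpnorm_powR (fun j => v j 0) r0); apply: ler_pM.
  - by [].
  - exact: powR_ge0.
  - by apply: le_trans (expR_ge1Dx _); lra.
  - apply: ge0_ler_powR; rewrite ?nnegrE ?(ltW r0) ?lpnorm_ge0//.
    exact: le_trans (lpnorm_ge0 _ _) vM.
exists (4 * ln (2 * n%:R)).
(* That 4 log(2n) >= 2 reduces to e^(1/2) <= 2, which follows from 1 - 1/2 <= e^(-1/2). *)
have ln_half : 2^-1 <= ln (2 * n%:R) :> R.
  rewrite -ler_expR lnK ?posrE//.
  apply: (@le_trans _ _ 2); last by lra.
  have := expR_ge1Dx (- 2^-1 : R); rewrite expRN.
  rewrite -(ler_pM2r (expR_gt0 2^-1)) mulVf ?gt_eqF ?expR_gt0//; lra.
split=> //; first by lra.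
  exact: ltW.
move=> v M vM; set r := 4 * ln _.
have r0 : 0 < r by rewrite /r; lra.
have M0 : 0 <= M by exact: le_trans (lpnorm_ge0 _ _) vM.
have -> : expR (r / 2) = (2 * n%:R) ^+ 2.
  rewrite /r (_ : _ / 2 = ln (2 * n%:R) * 2%:R); last by field.
  by rewrite expRM_natr lnK ?posrE.
apply: (@le_trans _ _ (2 * (n%:R * M `^ r))).
  rewrite ler_wpM2l// mulr_natl -[n in leRHS]card_ord -sumr_const.
  apply: ler_sum => j _; apply: ge0_ler_powR; rewrite ?nnegrE ?(ltW r0)//.
  apply: le_trans vM; apply: (ler_lpnorm (fun j => v j 0)).
  by apply: le_trans ps2; rewrite lee_fin ler1n.
rewrite mulrA ler_wpM2r ?powR_ge0// expr2 ler_peMl ?(ltW two_n0)//; lra.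
Qed.

(** * Rademacher complexities as means of real suprema *)

Lemma rademacher_le (R : realType) (X : Type) (m : nat) (x : 'I_m -> X)
    (F : set (X -> R)) (K : {ffun 'I_m -> bool} -> R) :
  (forall f xi, F f -> `|signed_sum xi (fun i => f (x i))| <= K xi) ->
  (rademacher x F <= ((2 ^+ m)^-1 * \sum_xi m%:R^-1 * K xi)%:E)%E.
Proof.
move=> FK; rewrite /rademacher EFinM lee_wpmul2l ?lee_fin ?invr_ge0 ?exprn_ge0//.
rewrite -sumEFin; apply: lee_sum => xi _; rewrite EFinM.
rewrite lee_wpmul2l ?lee_fin ?invr_ge0//.
by apply: ge_ereal_sup => _ [f Ff <-]; rewrite lee_fin; exact: FK.
Qed.

(** The linear class is bounded on the sample, so the extended suprema are finite and equal the real
    ones. *)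
Lemma rademacher_linearE (R : realType) (n m : nat) (p : R)
    (x : 'I_m -> 'cV[R]_n) : 1 <= p ->
  rademacher_linear p%:E x =
  ((2 ^+ m)^-1 * \sum_xi m%:R^-1 * sup_abs (linear_outputs x p) xi)%:E.
Proof.
move=> p1; rewrite /rademacher_linear /rademacher EFinM; congr (_ * _)%E.
rewrite -sumEFin; apply: eq_bigr => xi _; rewrite EFinM; congr (_ * _)%E.
have bL := bounded_symmetric_linear x p1.
rewrite /sup_abs -ereal_sup_EFin; last 2 first.
- by exists (sup_abs (linear_outputs x p) xi) => _ [t Lt <-]; exact: sup_abs_ub.
- by have [L0 _ _] := bL; exists `|signed_sum xi (fun=> 0 : R)|, (fun=> 0).
congr ereal_sup; apply/seteqP; split => [_ [f [v v1 ->] <-]|_ [_ [t [v v1 tE] <-] <-]].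
  exists `|signed_sum xi (fun i => \sum_j v j 0 * x i j 0)| => //.
  by exists (fun i => \sum_j v j 0 * x i j 0) => //; exists v.
exists (fun z => \sum_j v j 0 * z j 0); first by exists v.
by congr (`|_|%:E); apply: eq_bigr => i _; rewrite tE.
Qed.

(** * Network classes *)

Lemma le_mul_ereal_inf (R : realType) (W : Type) (P : set W) (val : W -> R)
    (y K C : R) :
  0 <= K -> (forall w, P w -> y <= val w * K) ->
  (ereal_inf [set (val w)%:E | w in P] <= C%:E)%E -> y <= C * K.
Proof.
rewrite le_eqVlt => /predU1P[<- yK infC|K0 yK infC].
  (* For K = 0 a single element of [P] gives y <= 0. One exists, since the infimum of the empty set
     is +oo and not at most C. *)
  rewrite mulr0; apply: contrapT => y0; move: infC.
  rewrite (_ : [set _ | _ in _] = set0) ?ereal_inf0 ?leye_eq//.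
  by rewrite -subset0 => t [w Pw _]; have := yK w Pw; rewrite mulr0 => /y0.
rewrite -ler_pdivrMr// -lee_fin; apply: le_trans infC.
apply: le_ereal_inf_tmp => _ [w Pw <-].
by rewrite lee_fin ler_pdivrMr// yK.
Qed.

Section network_classes.
Context {R : realType} {m n d : nat} (x : 'I_m -> 'cV[R]_n) (p : R)
  (q : \bar R) (H : width).
Hypotheses (d_gt0 : (0 < d)%N) (p1 : 1 <= p) (q1 : (1 <= q)%E)
  (qp : (q <= hoelder_conjugate p%:E)%E).

Let K xi := sup_abs (iter d.-1 next_layer (linear_outputs x p)) xi.

Let K0 xi : 0 <= K xi.
Proof.
have [bT _] := sup_abs_iter d.-1 (bounded_symmetric_linear x p1).
by have [T0 _ _] := bT; apply: le_trans (sup_abs_ub xi bT T0).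
Qed.

(** Pairing a network with its width turns the infimum over widths and weights into one over a
    single set. *)
Let weights (f : 'cV[R]_n -> R) : set {h & network R n h d} :=
  [set w | widths H (projT1 w) /\ net_fun (projT2 w) = f].

Let weights_psi f w xi : weights f w ->
  `|signed_sum xi (fun i => f (x i))| <= net_psi p%:E q (projT2 w) * K xi.
Proof. by case: w => h w [_ <-]; exact: net_signed_sum. Qed.

Lemma net_class_psi_signed_sum (psi : R) f xi :
  net_class_psi p%:E q d H psi f ->
  `|signed_sum xi (fun i => f (x i))| <= psi * K xi.
Proof.
move=> [_ fpsi].
apply: (@le_mul_ereal_inf _ _ (weights f) (fun w => net_psi p%:E q (projT2 w))) => //.
  by move=> w fw; exact: weights_psi.
apply: le_trans fpsi; apply: ereal_inf_le_tmp => _ [h Hh [w fw ->]].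
by exists (existT _ h w).
Qed.

(** The bound by a d-th power is solved for [net_mu]: with s the d-th root of y/K it reads s D <=
    [net_mu], a lower bound that passes to the infimum. *)
Lemma net_class_mu_signed_sum (mu : R) f xi : 0 <= mu ->
  net_class_mu p%:E q d H mu f ->
  `|signed_sum xi (fun i => f (x i))| <=
  (mu / d%:R `^ fine q^-1%E) ^+ d * K xi.
Proof.
move=> mu0 [[h0 Hh0 [w0 fw0]] fmu].
set y := `|_|; set D := d%:R `^ _.
have D0 : 0 < D by apply: powR_gt0; rewrite ltr0n.
have yw w : weights f w ->
    y <= (net_mu p%:E q (projT2 w) / D) ^+ d * K xi.
  move=> fw; apply: le_trans (weights_psi xi fw) _.
  by rewrite ler_wpM2r//; apply: prod_le_lpnorm => // k; exact: layer_norms_ge0.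
(* If the supremum is zero, the weights [w0] alone give y <= 0; otherwise it can be divided by. *)
have [Kxi0|Kxi0] := eqVneq (K xi) 0.
  have := weights_psi xi (conj Hh0 fw0 : weights f (existT _ h0 w0)).
  by rewrite Kxi0 !mulr0.
have Kpos : 0 < K xi by rewrite lt0r Kxi0 K0.
pose s := (y / K xi) `^ d%:R^-1.
have s0 : 0 <= s by exact: powR_ge0.
have sd : s ^+ d = y / K xi.
  have dR0 : d%:R != 0 :> R by rewrite pnatr_eq0 -lt0n.
  by rewrite -powR_mulrn// -powRrM mulVf// powRr1// divr_ge0// /y normr_ge0.
have le_s u : 0 <= u -> y <= (u / D) ^+ d * K xi -> s * D <= u.
  move=> u0; rewrite -ler_pdivrMr// -sd -ler_pdivlMr//.
  by rewrite ler_pXn2r ?nnegrE ?divr_ge0 ?(ltW D0).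
rewrite -ler_pdivrMr// -sd ler_pXn2r ?nnegrE ?divr_ge0 ?(ltW D0)//.
rewrite ler_pdivlMr// -lee_fin; apply: le_trans fmu.
apply: le_ereal_inf_tmp => _ [h Hh [w fw ->]]; rewrite lee_fin.
apply: le_s; first exact: lpnorm_ge0.
by apply: (yw (existT _ h w)).
Qed.

Lemma rademacher_net_le (F : set ('cV[R]_n -> R)) (C : R) : 0 <= C ->
  (forall f xi, F f -> `|signed_sum xi (fun i => f (x i))| <= C * K xi) ->
  (rademacher x F <= (C * 2 ^+ d.-1)%:E * rademacher_linear p%:E x)%E.
Proof.
move=> C0 FC; apply: le_trans (rademacher_le FC) _.
rewrite rademacher_linearE// -EFinM lee_fin -!mulr_sumr.
have [_ sumK] := sup_abs_iter d.-1 (bounded_symmetric_linear x p1).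
rewrite [leLHS](_ : _ = C * ((2 ^+ m)^-1 * (m%:R^-1 * \sum_xi K xi))); last first.
  by rewrite /K; ring.
rewrite [leRHS](_ : _ = C * ((2 ^+ m)^-1 * (m%:R^-1 * (2 ^+ d.-1 *
    \sum_xi sup_abs (linear_outputs x p) xi)))); last by ring.
by do 3!(rewrite ler_wpM2l ?invr_ge0 ?exprn_ge0 ?ler0n//).
Qed.

End network_classes.

(** The minimum and the complexity are named as reals [r] and [l], so that square roots can be
    handled in R. *)
Lemma rademacher_linear_le (R : realType) (n m : nat) (p : R)
    (x : 'I_m -> 'cV[R]_n) : (0 < n)%N -> (0 < m)%N -> 1 <= p <= 2 ->
  let pstar := hoelder_conjugate p%:E in
  exists r l : R,
    [/\ 0 <= r, Order.min pstar (4 * ln (2 * n%:R))%:E = r%:E,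
        rademacher_linear p%:E x = l%:E, 0 <= l &
        l <= Num.sqrt
          (r * (\big[Num.max/0]_(i < m) (vnorm pstar (x i) ^+ 2)) * m%:R^-1)].
Proof.
move=> n0 m0 p12 pstar; have /andP[p1 _] := p12.
have [r [rE r2 rp xM]] := log_exponent n0 p12.
set M2 := \big[_/_]_(_ < _) _.
have M20 : 0 <= M2 by apply: bigmax_ge_id.
exists r, ((2 ^+ m)^-1 * \sum_xi m%:R^-1 * sup_abs (linear_outputs x p) xi).
have r0 : 0 <= r by lra.
have bL := bounded_symmetric_linear x p1.
split => //; first exact: rademacher_linearE.
  rewrite mulr_ge0 ?invr_ge0 ?exprn_ge0// sumr_ge0// => xi _.
  rewrite mulr_ge0 ?invr_ge0 ?ler0n//.
  by have [T0 _ _] := bL; apply: le_trans (sup_abs_ub xi bL T0).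
have := @mean_sup_abs_linear_le _ _ _ x p m0 p1 r (Num.sqrt M2) r2 rp (sqrtr_ge0 _).
have xM2 i : vnorm pstar (x i) <= Num.sqrt M2.
  rewrite -[leLHS]ger0_norm ?lpnorm_ge0// -sqrtr_sqr ler_wsqrtr//.
  exact: (le_bigmax _ (fun i => vnorm pstar (x i) ^+ 2)).
move=> /(_ (fun i => xM _ _ (xM2 i))) mean.
have mR0 : 0 < m%:R :> R by rewrite ltr0n.
rewrite -mulr_sumr mulrCA ler_pdivrMl//; apply: le_trans mean _.
rewrite -sqrtrM ?mulr_ge0 ?ler0n//.
(* The root of m^2 cancels the factor 1/m of the complexity. *)
rewrite (_ : r * m%:R * M2 = m%:R ^+ 2 * (r * M2 / m%:R)); last first.
  by field; rewrite gt_eqF.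
by rewrite sqrtrM ?sqr_ge0// sqrtr_sqr gtr0_norm.
Qed.

Theorem corollary4 (R : realType) (n d m : nat) (p : R) (q : \bar R)
    (H : width) (psi mu : R) (x : 'I_m -> 'cV[R]_n)
    (hn : (0 < n)%N) (hd : (1 <= d)%N) (hm : (0 < m)%N)
    (hp : 1 <= p) (hq1 : (1 <= q)%E) (hq : (q <= hoelder_conjugate p%:E)%E)
    (hH : (1 <= width_ereal R H)%E) (hpsi : 0 <= psi) (hmu : 0 <= mu) :
  let pstar : \bar R := hoelder_conjugate p%:E in
  let invq : R := fine (q^-1)%E in
  let e : R := Num.max (fine (pstar^-1)%E - invq) 0 in
  let logterm : \bar R := Order.min pstar (4 * ln (2 * n%:R))%:E in
  let maxnorm2 : R := \big[Num.max/0]_(i < m) (vnorm pstar (x i) ^+ 2) in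
  let Rlin : \bar R := rademacher_linear p%:E x in
  let c : R := 2 * mu / (d%:R `^ invq) in
  [/\ (rademacher x (net_class_psi p%:E q d H psi)
         <= (psi * 2 ^+ (d - 1))%:E * Rlin)%E,
      (p <= 2 ->
         ((psi * 2 ^+ (d - 1))%:E * Rlin
         <= sqrte ((psi ^+ 2)%:E
                   * (2%:E * poweR (width_ereal R H) e) ^+ (2 * (d - 1))%N
                   * logterm * maxnorm2%:E * (m%:R^-1)%:E))%E),
      (rademacher x (net_class_mu p%:E q d H mu) <= (c ^+ d)%:E * Rlin)%E &
      (p <= 2 ->
         ((c ^+ d)%:E * Rlin
         <= sqrte ((c ^+ (2 * d))%:E * logterm * maxnorm2%:E
                   * (m%:R^-1)%:E))%E)].
Proof.
move=> pstar invq e logterm maxnorm2 Rlin c.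
have c0 : 0 <= c by rewrite divr_ge0 ?mulr_ge0 ?powR_ge0.
(* From q <= p^* follows 1/p^* <= 1/q, also for infinite exponents. *)
have e0 : e = 0.
  apply/max_idPr; rewrite subr_le0 /invq /pstar.
  move: (hoelder_conjugate p%:E) hq hq1 => [s| |]; move: (q) => [r| |] sr r1;
    try discriminate; rewrite ?invey// !lee_fin in sr r1 *.
  - have r0 : 0 < r by exact: lt_le_trans r1.
    have s0 : 0 < s by exact: lt_le_trans sr.
    by rewrite !inver !gt_eqF//= lef_pV2.
  - by rewrite inver; case: ifP => //= _; rewrite invr_ge0; lra.
(* Both second inequalities are instances, with a = psi 2^(d-1) and a = c^d. *)
have scaled (a : R) : 0 <= a -> p <= 2 ->
    (a%:E * Rlin <= sqrte ((a ^+ 2)%:E * logterm * maxnorm2%:E * (m%:R^-1)%:E))%E.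
  move=> a0 p2; have p12 : 1 <= p <= 2 by rewrite hp.
  have [r [l [r0 rE lE l0 lle]]] := rademacher_linear_le x hn hm p12.
  rewrite /Rlin lE /logterm rE -!EFinM /= lee_fin.
  have -> : a ^+ 2 * r * maxnorm2 / m%:R = a ^+ 2 * (r * maxnorm2 / m%:R).
    by rewrite !mulrA.
  by rewrite sqrtrM ?sqr_ge0// sqrtr_sqr ger0_norm// ler_wpM2l.
rewrite subn1; split.
- apply: rademacher_net_le => // f xi; exact: net_class_psi_signed_sum.
(* The width enters to the power 0, so its factor is 1 even when it is infinite. *)
- move=> p2; rewrite e0 poweRe0 mule1 -EFin_expe -EFinM.
  rewrite mulnC exprM -exprMn; apply: scaled => //.
  by rewrite mulr_ge0 ?exprn_ge0.
(* The networks give the factor 2^(d-1), weakened to the 2^d contained in c^d because the linear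
   complexity is nonnegative. *)
- apply: (@le_trans _ _ (((mu / d%:R `^ invq) ^+ d * 2 ^+ d.-1)%:E * Rlin)%E).
    apply: rademacher_net_le => //; first by rewrite exprn_ge0 ?divr_ge0 ?powR_ge0.
    by move=> f xi; exact: net_class_mu_signed_sum.
  have Rlin0 : (0 <= Rlin)%E.
    rewrite /Rlin rademacher_linearE// lee_fin.
    rewrite mulr_ge0 ?invr_ge0 ?exprn_ge0// sumr_ge0// => xi _.
    have bL := bounded_symmetric_linear x hp.
    rewrite mulr_ge0 ?invr_ge0 ?ler0n//.
    by have [T0 _ _] := bL; apply: le_trans (sup_abs_ub xi bL T0).
  rewrite lee_wpmul2r// lee_fin /c.
  have -> : 2 * mu / d%:R `^ invq = mu / d%:R `^ invq * 2 by ring.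
  rewrite [leRHS]exprMn ler_wpM2l ?exprn_ge0 ?divr_ge0 ?powR_ge0//.
  by rewrite ler_weXn2l ?ler1n// leq_pred.
- move=> p2; rewrite mulnC exprM; apply: scaled => //.
  exact: exprn_ge0.
Qed.
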